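(* Let $\mu$ be a probability on $(E,\mathscr{E})$, $\{P_{t},t\geq0\}$ a strongly continuous Markov semigroup on $L^{2}(\mu)$ with invariant distribution $\mu$ and generator $(L,\mathcal{D}^{2}(L,\mu))$, and $Q$ a $\mu$-isometric involution. Assume $\mathcal{A}$ is a core for $(L,\mathcal{D}^{2}(L,\mu))$ such that (1) $f\in\mathcal{A}$ implies $Qf\in\mathcal{A}$, and (2) $\langle Lf,g\rangle_{\mu}=\langle f,QLQg\rangle_{\mu}$ for all $f,g\in\mathcal{A}$. Then $\{P_{t},t\geq0\}$ is $(\mu,Q)$-self-adjoint, i.e. $\langle P_{t}f,g\rangle_{\mu}=\langle f,QP_{t}Qg\rangle_{\mu}$ for all $f,g\in L^{2}(\mu)$ and $t\geq0$.
   Context: $\mathcal{D}^{2}(L,\mu)=\{f\in L^{2}(\mu):\lim_{t\downarrow0}\|t^{-1}(P_{t}-{\rm Id})f-Lf\|_{\mu}=0\}$. A $\mu$-isometric involution is a linear $Q$ on $L^{2}(\mu)$ with $\langle Qf,Qg\rangle_{\mu}=\langle f,g\rangle_{\mu}$ and $Q^{2}={\rm Id}$. A subspace $\mathcal{A}\subset\mathcal{D}^{2}(L,\mu)$ is a core for $L$ if the closure (in the graph norm $\|f\|_{\mu}+\|Lf\|_{\mu}$) of the restriction of $L$ to $\mathcal{A}$ is $L$. *)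

(* Defs.v *)
(* L^2(mu) is modelled by (measurable, square-integrable)
   functions E -> R; equalities in L^2 are read mu-almost everywhere. *)
From HB Require Import structures.
From mathcomp Require Import all_boot all_order all_algebra.
From mathcomp Require Import all_classical all_reals all_analysis.
Set Implicit Arguments. Unset Strict Implicit. Unset Printing Implicit Defensive.
Import Order.TTheory GRing.Theory Num.Theory.
Import numFieldNormedType.Exports.
Local Open Scope classical_set_scope.
Local Open Scope ring_scope.

Section L2defs.
Context {d : measure_display} {E : measurableType d} {R : realType}
  (mu : {measure set E -> \bar R}).

Definition L2 (f : E -> R) : Prop :=
  measurable_fun setT f /\ mu.-integrable setT (fun x => ((f x) ^+ 2)%:E).

Definition aeq (f g : E -> R) : Prop := {ae mu, forall x, f x = g x}.

Definition ip (f g : E -> R) : R := fine (\int[mu]_x (f x * g x)%:E).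

Definition norm2 (f : E -> R) : R := Num.sqrt (fine (\int[mu]_x ((f x) ^+ 2)%:E)).

Definition L2_linop (T : (E -> R) -> (E -> R)) : Prop :=
  [/\ (forall f, L2 f -> L2 (T f)),
      (forall f g, L2 f -> L2 g -> aeq f g -> aeq (T f) (T g)) &
      (forall (a b : R) f g, L2 f -> L2 g ->
         aeq (T (fun x => a * f x + b * g x)) (fun x => a * T f x + b * T g x))].

(* strongly continuous Markov semigroup on L^2(mu) with invariant distribution mu;
   P t is only meaningful for t >= 0 *)
Definition Markov_semigroup (P : R -> (E -> R) -> (E -> R)) : Prop :=
  [/\ (forall t, 0 <= t -> L2_linop (P t)),
      (forall f, L2 f -> aeq (P 0 f) f),
      (forall s t f, 0 <= s -> 0 <= t -> L2 f -> aeq (P (s + t) f) (P s (P t f))),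
      (forall t f, 0 <= t -> L2 f -> {ae mu, forall x, 0 <= f x} ->
          {ae mu, forall x, 0 <= P t f x}) &
      (forall t, 0 <= t -> aeq (P t (fun _ => 1)) (fun _ => 1)) ] /\
  (forall t f, 0 <= t -> L2 f -> ip (P t f) (fun _ => 1) = ip f (fun _ => 1)) /\
  (forall f, L2 f ->
     norm2 (fun x => P t f x - f x) @[t --> 0^'+] --> 0).

(* f is in D^2(L, mu) and L f = g (as element of L^2) *)
Definition gen_at (P : R -> (E -> R) -> (E -> R)) (f g : E -> R) : Prop :=
  L2 f /\ L2 g /\
  norm2 (fun x => t^-1 * (P t f x - f x) - g x) @[t --> 0^'+] --> 0.

Definition D2 (P : R -> (E -> R) -> (E -> R)) (f : E -> R) : Prop :=
  exists g, gen_at P f g.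

Definition is_generator (P : R -> (E -> R) -> (E -> R)) (L : (E -> R) -> (E -> R)) : Prop :=
  forall f, D2 P f -> gen_at P f (L f).

Definition isometric_involution (Q : (E -> R) -> (E -> R)) : Prop :=
  [/\ L2_linop Q,
      (forall f g, L2 f -> L2 g -> ip (Q f) (Q g) = ip f g) &
      (forall f, L2 f -> aeq (Q (Q f)) f)].

(* A is a core for (L, D^2(L, mu)): a linear subspace of D^2(L,mu) such that the
   closure in graph norm of the graph of L restricted to A is the graph of L *)
Definition is_core (P : R -> (E -> R) -> (E -> R)) (L : (E -> R) -> (E -> R))
  (A : set (E -> R)) : Prop :=
  [/\ (forall f, A f -> D2 P f),
      A (fun _ => 0),
      (forall (a b : R) f g, A f -> A g -> A (fun x => a * f x + b * g x)) &
      (forall f g, L2 f -> L2 g ->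
        ((exists u : nat -> E -> R, (forall n, A (u n)) /\
            norm2 (fun x => u n x - f x) @[n --> \oo] --> 0 /\
            norm2 (fun x => L (u n) x - g x) @[n --> \oo] --> 0)
         <-> (D2 P f /\ aeq g (L f))))].

End L2defs.

(* Main.v *)
(* For f, h in the domain of L, set phi(s) = <P_s f, Q P_(t-s) h>. On a step of length e,
   phi(s + e) - phi(s) equals, up to e times the error of the difference quotients of f
   and h, the quantity e (<L P_s f, Q P_(t-s-e) h> - <Q P_s f, L P_(t-s-e) h>), which
   vanishes since the symmetry relation passes from the core to the whole domain. As P is
   contractive the errors are uniform in s, so summing over steps of length t/n and
   letting n -> oo gives phi(t) = phi(0), without differentiating phi. Density of the
   domain then gives the identity on L^2: limits of Riemann sums of s |-> P_s f, which
   exist because L^2 is complete, lie in the domain. Contractivity is Jensen's inequality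
   for x^2, applied through finite maxima of its tangents, which preserve L^2. *)

Require Import Defs.
From HB Require Import structures.
From mathcomp Require Import all_boot all_order all_algebra.
From mathcomp Require Import all_classical all_reals all_analysis.
From mathcomp Require Import measurable_realfun ring lra.
Set Implicit Arguments. Unset Strict Implicit. Unset Printing Implicit Defensive.
Import Order.TTheory GRing.Theory Num.Theory.
Import numFieldNormedType.Exports.
Local Open Scope classical_set_scope.
Local Open Scope ring_scope.

(** * Square-integrable functions: closure properties, inner product, almost everywhere equality *)

Section SquareIntegrable.
Context {d : measure_display} {E : measurableType d} {R : realType}
  (mu : {measure set E -> \bar R}).
Implicit Types f g h : E -> R.

(** The integrable majorant bounds the square of [f], so stability under linear combinations and
    maxima reduces to pointwise algebra. *)
Lemma L2_dominated f h : measurable_fun setT f ->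
  mu.-integrable setT (EFin \o h) -> (forall x, f x ^+ 2 <= h x) -> L2 mu f.
Proof.
move=> mf ih fh; split => //.
apply: le_integrable ih => //.
  exact/measurable_EFinP/measurable_funX.
move=> x _ /=; rewrite lee_fin !ger0_norm ?sqr_ge0//.
by rewrite (le_trans _ (fh x))// sqr_ge0.
Qed.

Lemma L2_sqr_integrableD a b f g : L2 mu f -> L2 mu g ->
  mu.-integrable setT (EFin \o (fun x => a * f x ^+ 2 + b * g x ^+ 2)).
Proof.
move=> [mf If] [mg Ig].
have -> : EFin \o (fun x => a * f x ^+ 2 + b * g x ^+ 2) =
  (fun x => a%:E * (f x ^+ 2)%:E)%E \+ (fun x => b%:E * (g x ^+ 2)%:E)%E.
  by apply/funext => x /=; rewrite EFinD !EFinM.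
by apply: integrableD => //; exact: integrableZl.
Qed.

Lemma L2_lin a b f g : L2 mu f -> L2 mu g -> L2 mu (fun x => a * f x + b * g x).
Proof.
move=> Lf Lg.
(* The constants come from $(u+v)^2 \leq 2u^2 + 2v^2$, whose defect is $(u-v)^2$. *)
apply: (L2_dominated _ (L2_sqr_integrableD (2 * a ^+ 2) (2 * b ^+ 2) Lf Lg)).
  by apply: measurable_funD; apply: measurable_funM => //; [case: Lf|case: Lg].
move=> x; have := sqr_ge0 (a * f x - b * g x); nra.
Qed.

Lemma L2D f g : L2 mu f -> L2 mu g -> L2 mu (fun x => f x + g x).
Proof.
move=> Lf Lg; have := L2_lin 1 1 Lf Lg.
by congr (L2 mu _); apply/funext => x; rewrite !mul1r.
Qed.

Lemma L2B f g : L2 mu f -> L2 mu g -> L2 mu (fun x => f x - g x).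
Proof.
move=> Lf Lg; have := L2_lin 1 (-1) Lf Lg.
by congr (L2 mu _); apply/funext => x; rewrite mul1r mulN1r.
Qed.

Lemma L2Z a f : L2 mu f -> L2 mu (fun x => a * f x).
Proof.
move=> Lf; have := L2_lin a 0 Lf Lf.
by congr (L2 mu _); apply/funext => x; rewrite mul0r addr0.
Qed.

Lemma L2_0 : L2 mu (fun=> 0).
Proof.
apply: (@L2_dominated _ (fun=> 0)); first exact: measurable_cst.
  exact: integrable0.
by move=> x; rewrite expr0n.
Qed.

Lemma L2_max f g : L2 mu f -> L2 mu g -> L2 mu (fun x => Num.max (f x) (g x)).
Proof.
move=> Lf Lg; apply: (L2_dominated _ (L2_sqr_integrableD 1 1 Lf Lg)).
  by apply: measurable_maxr; [case: Lf|case: Lg].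
move=> x; rewrite !mul1r.
by case: (leP (f x) (g x)) => _; rewrite ?lerDl ?lerDr sqr_ge0.
Qed.

Lemma L2_mul_integrable f g : L2 mu f -> L2 mu g ->
  mu.-integrable setT (EFin \o (fun x => f x * g x)).
Proof.
move=> Lf Lg; apply: le_integrable (L2_sqr_integrableD 1 1 Lf Lg) => //.
  by apply/measurable_EFinP; apply: measurable_funM; [case: Lf|case: Lg].
move=> x _ /=; rewrite lee_fin !mul1r (@ger0_norm _ (_ + _)) ?addr_ge0 ?sqr_ge0//.
rewrite ler_norml; apply/andP; split.
  have := sqr_ge0 (f x + g x); have := sqr_ge0 (f x); have := sqr_ge0 (g x); nra.
have := sqr_ge0 (f x - g x); have := sqr_ge0 (f x); have := sqr_ge0 (g x); nra.
Qed.

Lemma ipC f g : ip mu f g = ip mu g f.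
Proof. by rewrite /ip; under eq_integral do rewrite mulrC. Qed.

Lemma ip_linl a b f g h : L2 mu f -> L2 mu g -> L2 mu h ->
  ip mu (fun x => a * f x + b * g x) h = a * ip mu f h + b * ip mu g h.
Proof.
move=> Lf Lg Lh; rewrite /ip.
have If := L2_mul_integrable Lf Lh; have Ig := L2_mul_integrable Lg Lh.
rewrite -!RintegralZl// -RintegralD//; last 2 first.
- by have := integrableZl measurableT a If; apply: eq_integrable => // x _ /=; rewrite EFinM.
- by have := integrableZl measurableT b Ig; apply: eq_integrable => // x _ /=; rewrite EFinM.
by apply: eq_Rintegral => x _; ring.
Qed.

Lemma ip_ge0 f : 0 <= ip mu f f.
Proof. by apply: Rintegral_ge0 => x _; rewrite -expr2 sqr_ge0. Qed.

Lemma norm2E f : norm2 mu f = Num.sqrt (ip mu f f).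
Proof. by []. Qed.

Lemma norm2_sqr f : norm2 mu f ^+ 2 = ip mu f f.
Proof. by rewrite norm2E sqr_sqrtr// ip_ge0. Qed.

Lemma norm2_ge0 f : 0 <= norm2 mu f.
Proof. exact: sqrtr_ge0. Qed.

Lemma norm2_sqrE f : L2 mu f ->
  (norm2 mu f ^+ 2)%:E = (\int[mu]_x (f x ^+ 2)%:E)%E.
Proof.
move=> [mf If]; rewrite norm2_sqr /ip fineK//.
exact: integrable_fin_num.
Qed.

Lemma ip_aeq f f' g g' : L2 mu f -> L2 mu f' -> L2 mu g -> L2 mu g' ->
  aeq mu f f' -> aeq mu g g' -> ip mu f g = ip mu f' g'.
Proof.
move=> [mf _] [mf' _] [mg _] [mg' _] ff gg; congr fine.
apply: ae_eq_integral => //.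
- exact/measurable_EFinP/measurable_funM.
- exact/measurable_EFinP/measurable_funM.
- by apply: filterS2 ff gg => x + + _ => -> ->.
Qed.

Lemma norm2_eq0 f : L2 mu f -> norm2 mu f = 0 -> aeq mu f (fun=> 0).
Proof.
move=> Lf f0; have := norm2_sqrE Lf; rewrite f0 expr0n/= => /esym int0.
have mf2 : measurable_fun setT (fun x => (f x ^+ 2)%:E).
  by apply/measurable_EFinP/measurable_funX; case: Lf.
have : (\int[mu]_x `|(f x ^+ 2)%:E|)%E = 0%E.
  by rewrite -[RHS]int0; apply: eq_integral => x _; rewrite gee0_abs// lee_fin sqr_ge0.
move/(ae_eq_integral_abs mu measurableT mf2).
apply: filterS => x /(_ Logic.I) /eqP.
by rewrite /= eqe sqrf_eq0 => /eqP.
Qed.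

Lemma aeq_refl f : aeq mu f f.
Proof. exact: nearW. Qed.

Lemma aeq_sym f g : aeq mu f g -> aeq mu g f.
Proof. by apply: filterS. Qed.

Lemma aeq_trans f g h : aeq mu f g -> aeq mu g h -> aeq mu f h.
Proof. by apply: filterS2 => x -> ->. Qed.

Lemma aeq_lin a b f f' g g' : aeq mu f f' -> aeq mu g g' ->
  aeq mu (fun x => a * f x + b * g x) (fun x => a * f' x + b * g' x).
Proof. by apply: filterS2 => x -> ->. Qed.

Lemma L2_linopB T f g : L2_linop mu T -> L2 mu f -> L2 mu g ->
  aeq mu (T (fun x => f x - g x)) (fun x => T f x - T g x).
Proof.
move=> [_ _ Tlin] Lf Lg; have := Tlin 1 (-1) _ _ Lf Lg.
have -> : (fun x => 1 * f x + -1 * g x) = (fun x => f x - g x).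
  by apply/funext => x; rewrite mul1r mulN1r.
have -> : (fun x => 1 * T f x + -1 * T g x) = (fun x => T f x - T g x).
  by apply/funext => x; rewrite mul1r mulN1r.
by [].
Qed.

End SquareIntegrable.

(** * Contractivity of Markov operators on L^2 of a finite measure *)

Section MarkovContraction.
Context {d : measure_display} {E : measurableType d} {R : realType}
  (mu : {measure set E -> \bar R}).
Hypothesis mu_fin : (mu setT < +oo)%E.
Implicit Types f g : E -> R.

Lemma L2_cst (c : R) : L2 mu (fun=> c).
Proof.
split; first exact: measurable_cst.
apply: measurable_bounded_integrable => //.
by exists `|c ^+ 2|; split => // M cM x _; exact: ltW.
Qed.

(** An enumeration of the rationals; an index that codes no rational gives 0. *)
Definition rational (n : nat) : R := ratr (odflt 0 (unpickle n)).

Lemma rational_dense (x e : R) : 0 < e -> exists n, x < rational n < x + e.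
Proof.
move=> e0; have [q] : exists q : rat, ratr q \in `]x, (x + e)[.
  by apply: rat_in_itvoo; rewrite ltrDl.
by rewrite in_itv/= => xq; exists (pickle q); rewrite /rational pickleK.
Qed.

(* The tangents of [x ^+ 2] at the first [n] rationals, so that only finitely many
   a.e. inequalities are needed at each stage. *)
Fixpoint sqr_minorant (n : nat) (x : R) : R :=
  if n is n'.+1 then
    Num.max (sqr_minorant n' x)
      (2 * rational n' * x + (- rational n' ^+ 2) * 1)
  else 0.

Lemma sqr_minorant_ge0 n x : 0 <= sqr_minorant n x.
Proof. by elim: n => //= n IH; rewrite le_max IH. Qed.

Lemma sqr_minorant_le n x : sqr_minorant n x <= x ^+ 2.
Proof.
elim: n => [|n IH] /=; first exact: sqr_ge0.
rewrite ge_max IH/=.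
by have := sqr_ge0 (x - rational n); nra.
Qed.

Lemma sqr_minorant_nd x : {homo sqr_minorant^~ x : n m / (n <= m)%N >-> n <= m}.
Proof.
apply: homo_leq => //; first exact: le_trans.
by move=> n /=; rewrite le_max lexx.
Qed.

(** The tangent of the square at $a$ lies below it at $x$ by exactly $(x-a)^2$; for $x < a < x +
    \min(1,e)$ this gap is less than $e$. *)
Lemma sqr_minorant_cvg x : sqr_minorant n x @[n --> \oo] --> x ^+ 2.
Proof.
apply/cvgrPdist_le => e e0.
have [k /andP[xk kx]] : exists k, x < rational k < x + Num.min 1 e.
  by apply: rational_dense; rewrite lt_min ltr01.
exists k.+1 => // n /= kn.
rewrite ger0_norm ?subr_ge0 ?sqr_minorant_le//.
have : 2 * rational k * x + (- rational k ^+ 2) * 1 <= sqr_minorant n x.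
  by rewrite (le_trans _ (sqr_minorant_nd x kn))//= le_max lexx orbT.
have : rational k < x + 1 by rewrite (lt_le_trans kx)// lerD2l ge_min lexx.
have : rational k < x + e by rewrite (lt_le_trans kx)// lerD2l ge_min lexx orbT.
move: xk; set a : R := rational k; nra.
Qed.

Lemma L2_sqr_minorant n f : L2 mu f -> L2 mu (fun x => sqr_minorant n (f x)).
Proof.
move=> Lf; elim: n => [|n IH] /=; first exact: L2_cst.
by apply: L2_max => //; apply: L2_lin => //; exact: L2_cst.
Qed.

Context (T : (E -> R) -> E -> R).
Hypothesis Tlin : L2_linop mu T.
Hypothesis Tpos : forall f, L2 mu f -> {ae mu, forall x, 0 <= f x} ->
  {ae mu, forall x, 0 <= T f x}.
Hypothesis T1 : aeq mu (T (fun=> 1)) (fun=> 1).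
Hypothesis Tinv : forall f, L2 mu f -> ip mu (T f) (fun=> 1) = ip mu f (fun=> 1).

Lemma Markov_le f g : L2 mu f -> L2 mu g -> (forall x, f x <= g x) ->
  {ae mu, forall x, T f x <= T g x}.
Proof.
move=> Lf Lg fg; have TB := L2_linopB Tlin Lg Lf.
have gf0 : {ae mu, forall x, 0 <= g x - f x} by apply: aeW => x; rewrite subr_ge0.
have := Tpos (L2B Lg Lf) gf0 => TB0.
by apply: filterS2 TB TB0 => x ->; rewrite subr_ge0.
Qed.

(** Jensen's inequality for a finite maximum of affine functions: [T] commutes with affine functions
    because it is linear and fixes 1, and by positivity the image of a maximum dominates the image
    of each member. *)
Lemma Markov_sqr_minorant n f : L2 mu f ->
  {ae mu, forall x, sqr_minorant n (T f x) <= T (fun y => sqr_minorant n (f y)) x}.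
Proof.
move=> Lf; elim: n => [|n IH].
  by apply: Tpos (aeW _ _) => //=; exact: L2_cst.
have L1 := L2_cst 1.
pose a := rational n.
have Ln := L2_sqr_minorant n Lf.
have Ll := L2_lin (2 * a) (- a ^+ 2) Lf L1.
have LS := L2_sqr_minorant n.+1 Lf.
have h1 := Markov_le Ln LS.
have {}h1 := h1 (fun x => sqr_minorant_nd (f x) (leqnSn n)).
have h2 : {ae mu, forall x, T (fun x => 2 * a * f x + (- a ^+ 2) * 1) x <=
    T (fun y => sqr_minorant n.+1 (f y)) x}.
  by apply: Markov_le => // x /=; rewrite le_max lexx orbT.
have [_ _ Tl] := Tlin.
have h3 := Tl (2 * a) (- a ^+ 2) _ _ Lf L1.
have hA : {ae mu, forall x, sqr_minorant n (T f x) <=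
    T (fun y => sqr_minorant n.+1 (f y)) x}.
  by apply: filterS2 IH h1 => x; exact: le_trans.
have hB : {ae mu, forall x, 2 * a * T f x + (- a ^+ 2) * 1 <=
    T (fun y => sqr_minorant n.+1 (f y)) x}.
  by apply: filterS3 T1 h3 h2 => x t1 e3; rewrite e3 t1.
by apply: filterS2 hA hB => x l1 l2; rewrite ge_max l1.
Qed.

(** With $s_n$ the minorants, $\int s_n(Tf) \leq \int T(s_n(f)) = \int s_n(f) \leq \int f^2$ by
    invariance; monotone convergence in $n$ gives $\int (Tf)^2$ on the left. *)
Lemma Markov_contraction f : L2 mu f -> norm2 mu (T f) <= norm2 mu f.
Proof.
move=> Lf; have LT : L2 mu (T f) by case: Tlin => + _ _; apply.
have [mT _] := LT.
rewrite -(ler_pXn2r (n := 2)) ?nnegrE ?norm2_ge0// -lee_fin !norm2_sqrE//.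
have mg n : measurable_fun setT (fun x => (sqr_minorant n (T f x))%:E).
  by apply/measurable_EFinP; case: (L2_sqr_minorant n LT).
have g0 n x : setT x -> (0 <= (sqr_minorant n (T f x))%:E)%E.
  by move=> _; rewrite lee_fin sqr_minorant_ge0.
have gnd x : setT x ->
    {homo (fun n => (sqr_minorant n (T f x))%:E) : n m / (n <= m)%N >-> (n <= m)%E}.
  by move=> _ n m nm; rewrite lee_fin sqr_minorant_nd.
have := cvg_monotone_convergence (mu := mu) measurableT mg g0 gnd.
have -> : (\int[mu]_x limn (fun n => (sqr_minorant n (T f x))%:E))%E =
    (\int[mu]_x (T f x ^+ 2)%:E)%E.
  apply: eq_integral => x _; apply/cvg_lim => //.
  exact/cvg_EFin/sqr_minorant_cvg/nearW.
move=> cvgT; rewrite -(cvg_lim _ cvgT)//; apply: lime_le.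
  by apply/cvg_ex; exists (\int[mu]_x (T f x ^+ 2)%:E)%E.
apply: nearW => n.
have Ln := L2_sqr_minorant n Lf.
have LTn : L2 mu (T (fun y => sqr_minorant n (f y))) by case: Tlin => + _ _; apply.
have int1 g : L2 mu g -> (\int[mu]_x (g x)%:E)%E = (ip mu g (fun=> 1))%:E.
  move=> Lg; rewrite /ip fineK.
    by apply: eq_integral => x _; rewrite mulr1.
  exact/integrable_fin_num/L2_mul_integrable/L2_cst.
have Mn := Markov_sqr_minorant n Lf.
(* The image [g] is nonnegative only almost everywhere, while the comparison of integrals asks for
   it at every point; hence the truncation [g']. *)
pose g := T (fun y => sqr_minorant n (f y)); pose g' x := Num.max (g x) 0.
have Lg' : L2 mu g' by apply: L2_max => //; exact: L2_cst.
have gg' : aeq mu g g'.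
  apply: filterS Mn => x Mx; rewrite /g' max_l// (le_trans _ Mx)//.
  exact: sqr_minorant_ge0.
apply: (@le_trans _ _ (\int[mu]_x (g' x)%:E)%E).
  apply: ae_ge0_le_integral => //.
  - by move=> x _; exact: g0.
  - by move=> x _; rewrite lee_fin le_max lexx orbT.
  - by apply/measurable_EFinP; case: Lg'.
  - by apply: filterS Mn => x Mx _; rewrite lee_fin le_max Mx.
rewrite int1// -(ip_aeq LTn Lg' (L2_cst 1) (L2_cst 1) gg' (aeq_refl _ _)).
rewrite Tinv// -int1//; apply: ge0_le_integral => //.
- by move=> x _; rewrite lee_fin sqr_minorant_ge0.
- by apply/measurable_EFinP; case: Ln.
- by apply/measurable_EFinP/measurable_funX; case: Lf.
- by move=> x _; rewrite lee_fin sqr_minorant_le.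
Qed.

End MarkovContraction.

(** * Completeness of L^2 (Riesz-Fischer) *)

Section Completeness.
Context {d : measure_display} {E : measurableType d} {R : realType}
  (mu : {measure set E -> \bar R}).
Implicit Types f g h : E -> R.

Lemma sum_geometric_half n : \sum_(0 <= k < n) (2 ^+ k)^-1 <= 2 :> R.
Proof.
suff : \sum_(0 <= k < n) (2 ^+ k)^-1 = 2 - 2 * (2 ^+ n)^-1 :> R.
  by move=> ->; rewrite gerBl mulr_ge0// invr_ge0 exprn_ge0.
elim: n => [|n IH]; first by rewrite big_geq// expr0 invr1 mulr1 subrr.
by rewrite big_nat_recr//= IH exprS invfM mulVKf// mulr2n; field; rewrite expf_neq0.
Qed.

(* [|a k| <= 2^-k + 2^k (a k)^2] by AM-GM. *)
Lemma cvg_of_weighted_increments (v : nat -> R) (c : R) :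
  (forall n, \sum_(0 <= k < n) 2 ^+ k * (v k.+1 - v k) ^+ 2 <= c) -> cvgn v.
Proof.
move=> vc; have -> : v = (fun n => v 0%N + series (telescope v) n).
  by apply/funext => n; exact: eq_sum_telescope.
apply: is_cvgD; first exact: is_cvg_cst.
apply: normed_cvg; apply: nondecreasing_is_cvgn.
  apply/nondecreasing_seqP => n.
  by rewrite /normed_series_of !seriesEnat/= big_nat_recr//= lerDl.
exists (2 + c) => _ [n _ <-]; rewrite /normed_series_of seriesEnat/=.
apply: (@le_trans _ _ (\sum_(0 <= k < n)
    ((2 ^+ k)^-1 + 2 ^+ k * (v k.+1 - v k) ^+ 2))).
  apply: ler_sum => k _; rewrite /telescope/=.
  set a := v k.+1 - v k; set p : R := 2 ^+ k.
  have p0 : 0 < p by rewrite exprn_gt0.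
  rewrite -(ler_pM2l p0) mulrDr mulfV ?gt_eqF// mulrA -expr2 -exprMn.
  have -> : p * `|a| = `|p * a| by rewrite normrM (gtr0_norm p0).
  rewrite -[X in _ <= _ + X]real_normK ?num_real//.
  have := sqr_ge0 (`|p * a| - 1); nra.
by rewrite big_split/= lerD// sum_geometric_half.
Qed.

Lemma limn_einf_ub (w : nat -> \bar R) (c : \bar R) :
  (forall n, (w n <= c)%E) -> (limn_einf w <= c)%E.
Proof.
move=> wc; rewrite limn_einf_lim; apply: lime_le; first exact: is_cvg_einfs.
apply: nearW => n; apply: ereal_inf_le; exists (w n); last exact: wc.
by exists n => //=.
Qed.

(** Fatou's lemma for the squares: almost everywhere $h^2$ is the lower limit of the $g_k^2$, whose
    integrals are at most $c^2$. *)
Lemma L2_fatou (g : nat -> E -> R) h c : measurable_fun setT h ->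
  (forall k, L2 mu (g k)) -> (forall k, norm2 mu (g k) <= c) ->
  {ae mu, forall x, g k x @[k --> \oo] --> h x} ->
  L2 mu h /\ norm2 mu h <= c.
Proof.
move=> mh Lg gc gh.
have c0 : 0 <= c by rewrite (le_trans _ (gc 0%N))// norm2_ge0.
have mg k : measurable_fun setT (fun x => (g k x ^+ 2)%:E).
  by apply/measurable_EFinP/measurable_funX; case: (Lg k).
have mh2 : measurable_fun setT (fun x => (h x ^+ 2)%:E).
  exact/measurable_EFinP/measurable_funX.
have hc : (\int[mu]_x (h x ^+ 2)%:E <= (c ^+ 2)%:E)%E.
  have -> : (\int[mu]_x (h x ^+ 2)%:E)%E =
      (\int[mu]_x limn_einf (fun k => (g k x ^+ 2)%:E))%E.
    apply: ae_eq_integral => //.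
      apply: (measurableT_comp (f := -%E)) => //.
      by apply: measurable_fun_limn_esup => k; exact: measurableT_comp.
    apply: filterS gh => x ghx _; apply/esym.
    apply: (cvg_limn_einf_sup _).1; apply: cvg_EFin; first exact: nearW.
    exact: cvgM.
  have g0 k x : setT x -> (0 <= (g k x ^+ 2)%:E)%E.
    by move=> _; rewrite lee_fin sqr_ge0.
  apply: (le_trans (fatou mu measurableT mg g0)).
  apply: limn_einf_ub => k; rewrite -norm2_sqrE// lee_fin.
  by rewrite ler_pXn2r// ?nnegrE ?norm2_ge0.
have Lh : L2 mu h.
  split => //; apply/integrableP; split => //.
  under eq_integral do rewrite gee0_abs ?lee_fin ?sqr_ge0//.
  exact: le_lt_trans hc (ltry _).
split => //; rewrite -(ler_pXn2r (n := 2)) ?nnegrE ?norm2_ge0//.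
by rewrite -lee_fin norm2_sqrE.
Qed.

(** Along a subsequence with increments of norm at most $2^{-k}$, the squared increments weighted by
    $2^k$ have a summable series of integrals. Their sum is thus finite almost everywhere, which
    forces pointwise convergence, and Fatou's lemma controls the distance of the whole sequence to
    the limit. *)
Lemma L2_complete (u : nat -> E -> R) : (forall n, L2 mu (u n)) ->
  (forall e : R, 0 < e -> exists M, forall m n, (M <= m)%N -> (M <= n)%N ->
     norm2 mu (fun x => u m x - u n x) <= e) ->
  exists2 l, L2 mu l & forall e : R, 0 < e -> exists M, forall n, (M <= n)%N ->
     norm2 mu (fun x => u n x - l x) <= e.
Proof.
move=> Lu cauchy.
have half_gt0 k : 0 < (2 ^+ k)^-1 :> R by rewrite invr_gt0 exprn_gt0.
have [M hM] := choice (fun k => cauchy _ (half_gt0 k)).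
(* The partial sum puts both [n_ k] and [n_ k.+1] beyond [M k], and the summand [k] makes the
   indices unbounded. *)
pose n_ k := (k + \sum_(i < k.+1) M i)%N.
have n_ge k : (k <= n_ k)%N by exact: leq_addr.
have Mn k : (M k <= n_ k)%N.
  by rewrite /n_ big_ord_recr/= addnA leq_addl.
have MnS k : (M k <= n_ k.+1)%N.
  rewrite (leq_trans (Mn k))// /n_ [leqRHS]addSn leqW// leq_add2l.
  by rewrite [leqRHS]big_ord_recr leq_addr.
pose v k := u (n_ k).
pose w k x := (2 ^+ k * (v k.+1 x - v k x) ^+ 2)%:E.
have Lv k : L2 mu (v k) by exact: Lu.
have w0 k x : setT x -> (0 <= w k x)%E.
  by move=> _; rewrite lee_fin mulr_ge0 ?sqr_ge0 ?exprn_ge0.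
have mw k : measurable_fun setT (w k).
  apply/measurable_EFinP; apply: measurable_funM => //.
  by apply: measurable_funX; case: (L2B (Lv k.+1) (Lv k)).
have iw k : (\int[mu]_x w k x <= ((2 ^+ k)^-1)%:E)%E.
  have Ld := L2B (Lv k.+1) (Lv k).
  have -> : (\int[mu]_x w k x)%E =
      (2 ^+ k * norm2 mu (fun x => v k.+1 x - v k x) ^+ 2)%:E.
    rewrite EFinM norm2_sqrE// -integralZl//; last by case: Ld.
  set a := norm2 mu _; have a_le : a <= (2 ^+ k)^-1 by exact: hM.
  have p0 := half_gt0 k; rewrite lee_fin.
  rewrite (@le_trans _ _ (2 ^+ k * (2 ^+ k)^-1 ^+ 2))//.
    by rewrite ler_wpM2l ?exprn_ge0// ler_pXn2r// nnegrE ?norm2_ge0 ?ltW.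
  by rewrite expr2 mulVKf// expf_neq0.
pose G x := (\sum_(k <oo) w k x)%E.
have G_fin : {ae mu, forall x, G x \is a fin_num}.
  have iG : mu.-integrable setT G.
    apply/integrableP; split.
      by apply: ge0_emeasurable_sum => // k x _ _; exact: w0.
    under eq_integral => x _.
      rewrite gee0_abs; last by apply: nneseries_ge0 => k _ _; exact: w0.
      over.
    rewrite integral_nneseries//.
    apply: (@le_lt_trans _ _ 2%:E); last exact: ltry.
    apply: lime_le.
      by apply: is_cvg_nneseries => k _ _; apply: integral_ge0 => x; exact: w0.
    apply: nearW => n.
    apply: (@le_trans _ _ (\sum_(0 <= k < n) ((2 ^+ k)^-1)%:E)%E).
      by apply: lee_sum => k _; exact: iw.
    by rewrite sumEFin lee_fin sum_geometric_half.
  by apply: filterS (integrable_ae measurableT iG) => x; apply.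
(* An upper limit is measurable without any convergence; it is the genuine limit wherever [G] is
   finite. *)
pose l x := fine (limn_esup (fun k => (v k x)%:E)).
have ml : measurable_fun setT l.
  apply: (measurableT_comp (fine_measurable measurableT)).
  apply: measurable_fun_limn_esup => k.
  by apply/measurable_EFinP; case: (Lv k).
have vl : {ae mu, forall x, v k x @[k --> \oo] --> l x}.
  apply: filterS G_fin => x Gx.
  have cv : cvgn (fun k => v k x).
    apply: (@cvg_of_weighted_increments _ (fine (G x))) => n.
    rewrite -lee_fin fineK// -sumEFin.
    by apply: nneseries_lim_ge => k _ _; exact: w0.
  have cvE : (v k x)%:E @[k --> \oo] --> (limn (fun k => v k x))%:E.
    by apply: cvg_EFin; [exact: nearW|exact: cv].
  by rewrite /l (cvg_limn_einf_sup cvE).2.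
have bound e N : (forall m n, (N <= m)%N -> (N <= n)%N ->
     norm2 mu (fun x => u m x - u n x) <= e) -> forall n, (N <= n)%N ->
   L2 mu (fun x => u n x - l x) /\ norm2 mu (fun x => u n x - l x) <= e.
  move=> hN n Nn.
  (* The shift by [N] puts every index of the subsequence in the range of the Cauchy bound. *)
  apply: (@L2_fatou (fun k x => u n x - v (k + N)%N x)).
  - by apply: measurable_funB => //; case: (Lu n).
  - by move=> k; exact: L2B.
  - by move=> k; apply: hN => //; rewrite (leq_trans _ (n_ge _))// leq_addl.
  - apply: filterS vl => x vlx; apply: cvgB; first exact: cvg_cst.
    by move: vlx; rewrite -(cvg_shiftn N).
exists l.
  have [N hN] := cauchy 1 ltr01.
  have [Lul _] := bound _ _ hN N (leqnn N).
  have := L2B (Lu N) Lul.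
  by congr (L2 mu _); apply/funext => x; rewrite subKr.
move=> e e0; have [N hN] := cauchy e e0; exists N => n Nn.
by have [] := bound _ _ hN n Nn.
Qed.

End Completeness.

(** * Cauchy-Schwarz and the triangle inequality for a positive semidefinite form *)

Section InnerProduct.
Context {R : realType} {H : lmodType R} (B : H -> H -> R).
Hypothesis BC : forall x y, B x y = B y x.
Hypothesis BDl : forall x y z, B (x + y) z = B x z + B y z.
Hypothesis BZl : forall a x z, B (a *: x) z = a * B x z.
Hypothesis B_ge0 : forall x, 0 <= B x x.

Definition nm (x : H) : R := Num.sqrt (B x x).

Lemma BDr x y z : B z (x + y) = B z x + B z y.
Proof. by rewrite BC BDl !(BC z). Qed.

Lemma BZr a x z : B z (a *: x) = a * B z x.
Proof. by rewrite BC BZl (BC z). Qed.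

Lemma BNl x z : B (- x) z = - B x z.
Proof. by rewrite -scaleN1r BZl mulN1r. Qed.

Lemma BNr x z : B z (- x) = - B z x.
Proof. by rewrite BC BNl BC. Qed.

Lemma BBl x y z : B (x - y) z = B x z - B y z.
Proof. by rewrite BDl BNl. Qed.

Lemma BBr x y z : B z (x - y) = B z x - B z y.
Proof. by rewrite BDr BNr. Qed.

Lemma nm_ge0 x : 0 <= nm x.
Proof. exact: sqrtr_ge0. Qed.

Lemma nm2 x : nm x ^+ 2 = B x x.
Proof. exact: sqr_sqrtr. Qed.

Lemma nmZ a x : nm (a *: x) = `|a| * nm x.
Proof.
by rewrite /nm BZl BZr mulrA -expr2 sqrtrM ?sqr_ge0// sqrtr_sqr.
Qed.

Lemma nmN x : nm (- x) = nm x.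
Proof. by rewrite -scaleN1r nmZ normrN1 mul1r. Qed.

Lemma nm0 : nm 0 = 0.
Proof. by rewrite -(scale0r 0) nmZ normr0 mul0r. Qed.

Lemma nmBC x y : nm (x - y) = nm (y - x).
Proof. by rewrite -nmN opprB. Qed.

(** The quadratic $t \mapsto B(x+ty, x+ty)$ is nonnegative. The form may be degenerate, so $B(y,y) =
    0$ is a case of its own. *)
Lemma cauchy_schwarz x y : B x y <= nm x * nm y.
Proof.
have q t : 0 <= B x x + 2 * t * B x y + t ^+ 2 * B y y.
  have := B_ge0 (x + t *: y); rewrite BDl !BDr !BZl !BZr (BC y x).
  by congr (0 <= _); ring.
have [y0|y0] := eqVneq (B y y) 0.
  rewrite /nm y0 sqrtr0 mulr0 leNgt; apply/negP => xy0.
  (* At this $t$ the quadratic, here affine, equals $-B(x,x) - 2 < 0$. *)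
  have := q (- (B x x + 1) / B x y).
  rewrite y0 mulr0 addr0 -mulrA divfK ?gt_eqF//.
  have := B_ge0 x; lra.
have yp : 0 < B y y by rewrite lt_def y0 B_ge0.
have h : B x y ^+ 2 <= B x x * B y y.
  (* This is the minimiser of the quadratic. *)
  have := q (- B x y / B y y).
  have -> : B x x + 2 * (- B x y / B y y) * B x y + (- B x y / B y y) ^+ 2 * B y y
     = (B x x * B y y - B x y ^+ 2) / B y y by field.
  by rewrite pmulr_lge0 ?invr_gt0// subr_ge0.
rewrite (le_trans (ler_norm _))// -sqrtr_sqr /nm -sqrtrM//.
by rewrite ler_sqrt// mulr_ge0.
Qed.

Lemma ler_nmD x y : nm (x + y) <= nm x + nm y.
Proof.
rewrite -(ler_pXn2r (n := 2)) ?nnegrE ?addr_ge0 ?nm_ge0//.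
rewrite nm2 BDl !BDr (BC y x) sqrrD !nm2.
have := cauchy_schwarz x y; lra.
Qed.

Lemma cauchy_schwarz_norm x y : `|B x y| <= nm x * nm y.
Proof.
by rewrite ler_norml cauchy_schwarz andbT lerNl -BNl -(nmN x) cauchy_schwarz.
Qed.

Lemma ler_nm_dist y x z : nm (x - z) <= nm (x - y) + nm (y - z).
Proof. by rewrite -[X in nm X](subrKA y) ler_nmD. Qed.

Lemma ler_nm_sum n (F : nat -> H) (e : R) :
  (forall k, (k < n)%N -> nm (F k) <= e) -> nm (\sum_(k < n) F k) <= n%:R * e.
Proof.
elim: n => [|n IH] Fe; first by rewrite big_ord0 nm0 mul0r.
rewrite big_ord_recr/= (le_trans (ler_nmD _ _))//.
rewrite -natr1 mulrDl mul1r lerD ?Fe//.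
by apply: IH => k kn; apply: Fe; rewrite ltnW.
Qed.

(** * Contraction semigroups on a complete space and the graph of the generator *)

Hypothesis H_complete : forall u : nat -> H,
  (forall e : R, 0 < e -> exists M, forall n, (M <= n)%N -> nm (u n - u M) <= e) ->
  exists l, forall e : R, 0 < e -> exists M, forall n, (M <= n)%N -> nm (u n - l) <= e.

Context (P : R -> H -> H).
Hypothesis P_lin : forall (t : R) a x y, 0 <= t -> P t (a *: x + y) = a *: P t x + P t y.
Hypothesis P_0 : forall x, P 0 x = x.
Hypothesis P_semi : forall (s t : R) x, 0 <= s -> 0 <= t -> P (s + t) x = P s (P t x).
Hypothesis P_contr : forall (t : R) x, 0 <= t -> nm (P t x) <= nm x.
Hypothesis P_cont : forall x (e : R), 0 < e -> exists2 r : R, 0 < r &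
  forall t : R, 0 <= t <= r -> nm (P t x - x) <= e.

Lemma PD t x y : 0 <= t -> P t (x + y) = P t x + P t y.
Proof. by move=> t0; rewrite -{1}(scale1r x) P_lin// scale1r. Qed.

Lemma P0r t : 0 <= t -> P t 0 = 0.
Proof.
move=> t0; apply: (addrI (P t 0)); by rewrite -PD// !addr0.
Qed.

Lemma PZ t a x : 0 <= t -> P t (a *: x) = a *: P t x.
Proof. by move=> t0; rewrite -[a *: x]addr0 P_lin// P0r// addr0. Qed.

Lemma PB t x y : 0 <= t -> P t (x - y) = P t x - P t y.
Proof. by move=> t0; rewrite -scaleN1r addrC P_lin// scaleN1r addrC. Qed.

Lemma P_sum t n (F : 'I_n -> H) : 0 <= t ->
  P t (\sum_(k < n) F k) = \sum_(k < n) P t (F k).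
Proof.
by move=> t0; rewrite (big_morph (P t) (id1 := 0) (op1 := +%R))// => [x y|];
  [exact: PD|exact: P0r].
Qed.

Lemma P_comm s t x : 0 <= s -> 0 <= t -> P s (P t x) = P t (P s x).
Proof. by move=> s0 t0; rewrite -!P_semi// addrC. Qed.

(* The graph of the generator, with the difference quotient multiplied out. *)
Definition generates (x y : H) := forall e : R, 0 < e -> exists2 r : R, 0 < r &
  forall t : R, 0 < t -> t <= r -> nm (P t x - x - t *: y) <= t * e.

(** The error at [P s x] is the image under [P s] of the error at [x]. This makes first-order errors
    uniform along an orbit. *)
Lemma generates_error_P s t x y : 0 <= s -> 0 <= t ->
  nm (P t (P s x) - P s x - t *: P s y) <= nm (P t x - x - t *: y).
Proof.
by move=> s0 t0; rewrite P_comm// -PZ// -!PB// P_contr.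
Qed.

(** * Riemann sums of orbits, their limits, and density of the domain *)

(** Left endpoints, without the factor [h]: in this form concatenation and refinement of grids are
    exact identities. *)
Definition riemann_sum (h : R) n x := \sum_(k < n) P (k%:R * h) x.

Local Notation RS := riemann_sum.

Lemma riemann_sumS h n x : RS h n.+1 x = RS h n x + P (n%:R * h) x.
Proof. exact: big_ord_recr. Qed.

Lemma riemann_sumD h a b x : 0 <= h ->
  RS h (a + b) x = RS h a x + P (a%:R * h) (RS h b x).
Proof.
move=> h0; have ah : 0 <= a%:R * h by rewrite mulr_ge0.
rewrite /RS big_split_ord/= P_sum//; congr (_ + _).
by apply: eq_bigr => i _; rewrite natrD mulrDl P_semi// mulr_ge0.
Qed.

(** A grid of [n * m] steps is a coarse grid of [n] blocks, each carrying a fine sum of [m] steps;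
    this compares a mesh with its refinement. *)
Lemma riemann_sumM h n m x : 0 <= h ->
  RS h (n * m) x = RS (m%:R * h) n (RS h m x).
Proof.
move=> h0; elim: n => [|n IH]; first by rewrite /RS !big_ord0.
by rewrite mulSn addnC riemann_sumD// IH riemann_sumS natrM mulrA.
Qed.

Lemma riemann_sumB h n x y : 0 <= h -> RS h n (x - y) = RS h n x - RS h n y.
Proof.
move=> h0; rewrite /RS -sumrB; apply: eq_bigr => i _.
by rewrite PB// mulr_ge0.
Qed.

Lemma P_riemann_sum t h n x : 0 <= t -> 0 <= h -> P t (RS h n x) = RS h n (P t x).
Proof.
move=> t0 h0; rewrite /RS P_sum//; apply: eq_bigr => i _.
by rewrite P_comm// mulr_ge0.
Qed.

Lemma nm_riemann_sum h n x : 0 <= h -> nm (RS h n x) <= n%:R * nm x.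
Proof.
move=> h0; rewrite /RS.
apply: (ler_nm_sum (F := fun k => P (k%:R * h) x)) => k _.
by rewrite P_contr// mulr_ge0.
Qed.

Lemma riemann_sum_error h n x r e : 0 <= h -> n%:R * h <= r ->
  (forall t : R, 0 <= t <= r -> nm (P t x - x) <= e) ->
  nm (RS h n x - n%:R *: x) <= n%:R * e.
Proof.
move=> h0 nhr Px; have -> : n%:R *: x = \sum_(k < n) x.
  by rewrite sumr_const card_ord scaler_nat.
rewrite /RS -sumrB.
apply: (ler_nm_sum (F := fun k => P (k%:R * h) x - x)) => k kn.
apply: Px; rewrite mulr_ge0//= (le_trans _ nhr)// ler_wpM2r// ler_nat.
exact: ltnW.
Qed.

Definition mesh (tau : R) j : R := tau / (2 ^ j)%:R.

Lemma mesh_ge0 tau j : 0 <= tau -> 0 <= mesh tau j.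
Proof. by move=> t0; rewrite /mesh divr_ge0. Qed.

Lemma mesh_small (tau r : R) : 0 <= tau -> 0 < r ->
  exists M, forall j, (M <= j)%N -> mesh tau j <= r.
Proof.
(* For [j] at least this integer part, $2^j > j$ gives $2^j \geq \lfloor \tau/r \rfloor + 1 >
   \tau/r$. *)
move=> t0 r0; exists (Num.truncn (tau / r)) => j Mj.
rewrite /mesh ler_pdivrMr ?ltr0n ?expn_gt0// mulrC -ler_pdivrMr//.
have /truncn_itv /andP[_ /ltW/le_trans] : 0 <= tau / r by rewrite divr_ge0// ltW.
by apply; rewrite ler_nat (leq_ltn_trans Mj)// ltn_expl.
Qed.

Definition dyadic_sum tau j x := mesh tau j *: RS (mesh tau j) (2 ^ j) x.

(** The level [j] sum is the coarse sum of level [i] applied to a fine sum over one coarse step.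
    Replacing that fine sum by $2^{j-i} x$ costs $2^{j-i} e$, the coarse sum multiplies norms by at
    most $2^i$, and the factor [h] turns the product into $\tau e$. *)
Lemma dyadic_sum_dist (tau : R) x e i j : 0 <= tau -> (i <= j)%N ->
  (forall t : R, 0 <= t <= mesh tau i -> nm (P t x - x) <= e) ->
  nm (dyadic_sum tau j x - dyadic_sum tau i x) <= tau * e.
Proof.
move=> t0 ij Px; set h := mesh tau j.
have h0 : 0 <= h by exact: mesh_ge0.
have hi : mesh tau i = (2 ^ (j - i))%:R * h.
  rewrite /h /mesh -{2}(subnK ij) expnD natrM.
  have : (2 ^ (j - i))%:R != 0 :> R by rewrite pnatr_eq0 expn_eq0.
  have : (2 ^ i)%:R != 0 :> R by rewrite pnatr_eq0 expn_eq0.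
  by move=> ? ?; field; apply/andP.
have mi0 : 0 <= mesh tau i by exact: mesh_ge0.
rewrite /dyadic_sum -/h -{1}(subnKC ij) expnD riemann_sumM// -hi.
rewrite {2}hi [_ * h]mulrC -[(h * _) *: _]scalerA.
have -> : (2 ^ (j - i))%:R *: RS (mesh tau i) (2 ^ i) x =
    RS (mesh tau i) (2 ^ i) ((2 ^ (j - i))%:R *: x).
  rewrite /RS scaler_sumr; apply: eq_bigr => k _.
  by rewrite PZ// mulr_ge0.
rewrite -scalerBr -riemann_sumB// nmZ ger0_norm//.
rewrite (le_trans (ler_wpM2l h0 (nm_riemann_sum _ _ mi0)))//.
have htau : tau = h * (2 ^ i)%:R * (2 ^ (j - i))%:R.
  rewrite /h /mesh -{1}(subnK ij) expnD natrM.
  have : (2 ^ (j - i))%:R != 0 :> R by rewrite pnatr_eq0 expn_eq0.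
  have : (2 ^ i)%:R != 0 :> R by rewrite pnatr_eq0 expn_eq0.
  by move=> ? ?; field; apply/andP.
rewrite [in leRHS]htau -!mulrA ler_wpM2l// ler_wpM2l//.
by rewrite ler_wpM2l//; apply: (riemann_sum_error h0 _ Px); rewrite hi.
Qed.

(** Stands for $u = \int_0^\tau P_s x\,ds$, as a limit of dyadic Riemann sums. *)
Definition is_integral tau x u := forall e : R, 0 < e ->
  exists M, forall j, (M <= j)%N -> nm (dyadic_sum tau j x - u) <= e.

Lemma integral_exists (tau : R) x : 0 < tau -> exists u, is_integral tau x u.
Proof.
move=> t0; apply: H_complete => e e0.
have [r r0 Pr] := P_cont x (divr_gt0 e0 t0).
have [M hM] := mesh_small (ltW t0) r0.
exists M => n Mn; rewrite -(divfK (lt0r_neq0 t0) e) mulrC.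
apply: dyadic_sum_dist => //; first exact: ltW.
move=> t /andP[? /le_trans tr]; apply: Pr; apply/andP; split => //.
exact/tr/hM.
Qed.

Lemma integral_dist tau x u e : 0 < tau -> is_integral tau x u ->
  (forall t : R, 0 <= t <= tau -> nm (P t x - x) <= e) ->
  nm (u - tau *: x) <= tau * e.
Proof.
move=> t0 xu Px; apply/ler_addgt0Pr => d d0.
have [M hM] := xu _ d0.
rewrite (le_trans (ler_nm_dist (dyadic_sum tau M x) _ _))// addrC lerD//.
  (* At level 0 the single node is 0, so the sum is [tau *: x] itself. *)
  have -> : tau *: x = dyadic_sum tau 0 x.
    by rewrite /dyadic_sum /mesh /RS expn0 divr1 big_ord1 mul0r P_0.
  apply: dyadic_sum_dist => //; first exact: ltW.
  by rewrite /mesh expn0 divr1.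
by rewrite nmBC hM.
Qed.

(* With [m h <= d < (m + 1) h], telescoping gives
   [P_(m h) S_n x - S_n x = S_m (P_tau x - x)] when [n h = tau]. *)
Lemma dyadic_sum_increment tau j x d e1 e2 : 0 < tau -> 0 <= d ->
  (forall t : R, 0 <= t <= mesh tau j -> nm (P t x - x) <= e1) ->
  (forall t : R, 0 <= t <= d -> nm (P t (P tau x - x) - (P tau x - x)) <= e2) ->
  nm (P d (dyadic_sum tau j x) - dyadic_sum tau j x - d *: (P tau x - x)) <=
  tau * e1 + d * e2 + mesh tau j * nm (P tau x - x).
Proof.
move=> t0 d0 Px Pg; set g := P tau x - x; set h := mesh tau j.
have h0 : 0 < h by rewrite /h /mesh divr_gt0// ltr0n expn_gt0.
have n_h : (2 ^ j)%:R * h = tau.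
  by rewrite /h /mesh mulrC divfK// pnatr_eq0 expn_eq0.
pose n := (2 ^ j)%N; pose m := Num.truncn (d / h).
have /truncn_itv /andP[] : 0 <= d / h by rewrite divr_ge0// ltW.
rewrite -/m ler_pdivlMr// ltr_pdivrMr// -natr1 mulrDl mul1r => mhd dmh.
have h0' := ltW h0.
have mh0 : 0 <= m%:R * h by rewrite mulr_ge0.
pose r := d - m%:R * h.
have r0 : 0 <= r by rewrite subr_ge0.
have rh : r <= h by rewrite /r; lra.
have key : P (m%:R * h) (RS h n x) - RS h n x = RS h m g.
  rewrite /g riemann_sumB// -P_riemann_sum//; last exact: ltW.
  rewrite -n_h -/n; apply/eqP; rewrite subr_eq addrAC eq_sym subr_eq; apply/eqP.
  by rewrite addrC -riemann_sumD// addrC -riemann_sumD// addnC.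
(* With [d = m%:R * h + r], the three terms of the bound come from the partial step [r], from
   replacing [RS h m g] by [m%:R *: g], and from the leftover [r *: g]. *)
have -> : P d (dyadic_sum tau j x) - dyadic_sum tau j x - d *: g =
    h *: P (m%:R * h) (RS h n (P r x - x)) +
    (h *: (RS h m g - m%:R *: g) - r *: g).
  have dE : d *: g = (h * m%:R) *: g + r *: g.
    by rewrite -scalerDl /r [h * _]mulrC addrC subrK.
  have dmr : d = m%:R * h + r by rewrite /r addrC subrK.
  rewrite dE /dyadic_sum -/h -/n PZ// dmr P_semi// P_riemann_sum//.
  rewrite riemann_sumB// PB// -key.
  move: g {Pg} dE key => g dE key.
  rewrite !scalerBr scalerA opprD !addrA.
  by rewrite subrK.
have nh : h * n%:R = tau by rewrite mulrC n_h.
rewrite (le_trans (ler_nmD _ _))// -addrA lerD//.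
  rewrite nmZ gtr0_norm// -[in leRHS]nh -[leRHS]mulrA ler_wpM2l//.
  rewrite (le_trans (P_contr _ _))// (le_trans (nm_riemann_sum _ _ _))//.
  by rewrite ler_wpM2l// Px// r0.
rewrite (le_trans (ler_nmD _ _))// lerD//.
  have e2_0 : 0 <= e2 by rewrite (le_trans _ (Pg 0 _)) ?nm_ge0// lexx.
  rewrite nmZ gtr0_norm// (@le_trans _ _ (h * (m%:R * e2)))//.
    by rewrite ler_wpM2l// (riemann_sum_error _ mhd).
  by rewrite mulrA [h * _]mulrC ler_wpM2r.
by rewrite nmN nmZ ger0_norm// ler_wpM2r// nm_ge0.
Qed.

(** The limit form of the increment estimate: $P_t u - u = \int_0^t P_s g\,ds$ with $g = P_\tau x -
    x$, which is $t g$ up to $t e$. *)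
Lemma integral_generates tau x u : 0 < tau -> is_integral tau x u ->
  generates u (P tau x - x).
Proof.
move=> t0 xu e e0; set g := P tau x - x.
have [r r0 Pg] := P_cont g e0.
exists r => // t tp tr; apply/ler_addgt0Pr => d d0.
have g0 : 0 < nm g + 1 by rewrite ltr_wpDl// nm_ge0.
(* The slack [d] is spent in quarters: two on replacing [u] by a dyadic sum (once under [P t]), one
   on the oscillation of the orbit of [x] over a mesh, one on the last partial step. *)
have c0 : 0 < d / 4 by rewrite divr_gt0.
have [M1 hM1] := xu _ c0.
have [r1 r10 Pr1] := P_cont x (divr_gt0 c0 t0).
have [M2 hM2] := mesh_small (ltW t0) r10.
have [M3 hM3] := mesh_small (ltW t0) (divr_gt0 c0 g0).
pose j := maxn M1 (maxn M2 M3).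
have {}hM1 := hM1 j (leq_maxl _ _).
have {}hM2 := hM2 j (leq_trans (leq_maxl _ _) (leq_maxr _ _)).
have {}hM3 := hM3 j (leq_trans (leq_maxr _ _) (leq_maxr _ _)).
have inc : nm (P t (dyadic_sum tau j x) - dyadic_sum tau j x - t *: g) <=
    d / 4 + t * e + d / 4.
  have := @dyadic_sum_increment tau j x t (d / 4 / tau) e t0 (ltW tp).
  move=> /(_ _ _)/le_trans; apply.
  - move=> s /andP[s0 sm]; apply: Pr1; rewrite s0/=; exact: le_trans hM2.
  - by move=> s /andP[s0 st]; apply: Pg; rewrite s0/=; exact: le_trans tr.
  rewrite mulrC divfK ?gt_eqF// lerD// -/g.
  rewrite (@le_trans _ _ (mesh tau j * (nm g + 1)))//.
    by apply: ler_wpM2l; [exact/mesh_ge0/ltW|rewrite lerDl].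
  by rewrite -ler_pdivlMr.
set v := dyadic_sum tau j x in hM1 inc *.
have -> : P t u - u - t *: g = P t (u - v) + ((P t v - v - t *: g) + (v - u)).
  by rewrite PB ?ltW// !addrA (subrK (P t v)) (addrAC _ _ v) subrK addrAC.
rewrite (le_trans (ler_nmD _ _))//.
rewrite (le_trans (lerD (P_contr _ (ltW tp)) (ler_nmD _ _)))//.
rewrite (nmBC u v); lra.
Qed.

(** The witness is the orbit average $r^{-1} \int_0^r P_s x\,ds$ over a short interval. *)
Lemma generates_dense x e : 0 < e ->
  exists u v, generates u v /\ nm (u - x) <= e.
Proof.
move=> e0; have [r r0 Pr] := P_cont x e0.
have [u xu] := integral_exists x r0.
exists (r^-1 *: u), (r^-1 *: (P r x - x)); split.
  move=> c c0; have [s s0 hs] := integral_generates r0 xu (mulr_gt0 r0 c0).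
  exists s => // t tp ts.
  rewrite (PZ _ _ (ltW tp)) scalerA mulrC -scalerA -!scalerBr nmZ gtr0_norm ?invr_gt0//.
  by rewrite ler_pdivrMl// mulrCA hs.
have -> : r^-1 *: u - x = r^-1 *: (u - r *: x).
  by rewrite scalerBr scalerA mulVf ?gt_eqF// scale1r.
rewrite nmZ gtr0_norm ?invr_gt0// ler_pdivrMl//.
exact: integral_dist.
Qed.

(** * Symmetry with respect to the involution, from the core to the semigroup *)

Context (Q : H -> H).
Hypothesis Q_sym : forall x y, B (Q x) y = B x (Q y).
Hypothesis Q_contr : forall x, nm (Q x) <= nm x.

(** Continuity of the form in both arguments; [e <= 1] bounds [nm v] by [nm y + 1], so the constant
    is free of [v] and [w]. *)
Lemma form_close e x y v w : e <= 1 -> nm (v - y) <= e -> nm (w - x) <= e ->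
  `|B y (Q x) - B v (Q w)| <= e * (nm x + nm y + 1).
Proof.
move=> e1 vy wx.
have -> : B y (Q x) - B v (Q w) = B (y - v) (Q x) + B (Q v) (x - w).
  by rewrite BBl BBr !Q_sym; ring.
rewrite (le_trans (ler_normD _ _))// -addrA mulrDr lerD//.
  rewrite (le_trans (cauchy_schwarz_norm _ _))// nmBC.
  by rewrite ler_pM ?nm_ge0.
rewrite (le_trans (cauchy_schwarz_norm _ _))// mulrC (nmBC x).
rewrite ler_pM ?nm_ge0// (le_trans (Q_contr _))//.
by rewrite -[v](subrK y) (le_trans (ler_nmD _ _))// [leLHS]addrC lerD2l (le_trans vy).
Qed.

Lemma eq_of_small (a b K : R) : (forall e, 0 < e <= 1 -> `|a - b| <= e * K) ->
  a = b.
Proof.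
move=> abK; have K0 : 0 <= K.
  by have := abK 1; rewrite ltr01 lexx mul1r => /(_ isT); apply: le_trans.
apply/eqP; rewrite -subr_eq0 -normr_le0; apply/ler_addgt0Pr => e e0.
have K1 : 0 < K + 1 by rewrite ltr_wpDl.
(* [K + 1] instead of [K], which may vanish. *)
pose d := Num.min 1 (e / (K + 1)).
have d01 : 0 < d <= 1.
  by rewrite /d lt_min ltr01 divr_gt0//= ge_min lexx.
rewrite add0r (le_trans (abK _ d01))//.
rewrite (@le_trans _ _ (e / (K + 1) * K))//.
  by rewrite ler_wpM2r// /d ge_min lexx orbT.
by rewrite mulrAC ler_pdivrMr// ler_wpM2l ?lerDl// ltW.
Qed.

(** Both sides are continuous in the graph norm, in which the relation [C], meant as the graph of
    the generator on a core, approximates the whole graph. *)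
Lemma form_symmetric_closure (C : H -> H -> Prop) :
  (forall x y, generates x y -> forall e, 0 < e ->
     exists u v, [/\ C u v, nm (u - x) <= e & nm (v - y) <= e]) ->
  (forall u v w z, C u v -> C w z -> B v (Q w) = B (Q u) z) ->
  forall x y x' y', generates x y -> generates x' y' ->
    B y (Q x') = B (Q x) y'.
Proof.
move=> Ccore Csym x y x' y' xy x'y'.
apply: (@eq_of_small _ _ ((nm x' + nm y + 1) + (nm x + nm y' + 1))).
move=> e /andP[e0 e1].
have [u [v [Cuv ux vy]]] := Ccore _ _ xy _ e0.
have [w [z [Cwz wx zy]]] := Ccore _ _ x'y' _ e0.
have h1 := form_close e1 vy wx.
have h2 := form_close e1 zy ux.
have -> : B y (Q x') - B (Q x) y' =
    (B y (Q x') - B v (Q w)) - (B y' (Q x) - B z (Q u)).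
  by rewrite (Csym _ _ _ _ Cuv Cwz) (BC (Q u)) (BC (Q x)); ring.
by rewrite (le_trans (ler_normB _ _))// mulrDr lerD.
Qed.

Hypothesis form_sym : forall x y x' y', generates x y -> generates x' y' ->
  B y (Q x') = B (Q x) y'.

Lemma generates_P s x y : 0 <= s -> generates x y -> generates (P s x) (P s y).
Proof.
move=> s0 xy e e0; have [r r0 hr] := xy e e0; exists r => // t tp tr.
by rewrite (le_trans (generates_error_P _ _ s0 (ltW tp)))// hr.
Qed.

(** One time step moved from the left factor to the right one. The first-order terms cancel by
    [form_sym], which applies since orbits stay in the domain; only the two difference-quotient
    errors remain. *)
Lemma form_step f f' h h' s r d c : generates f f' -> generates h h' ->
  0 <= s -> 0 <= r -> 0 <= d ->
  nm (P d f - f - d *: f') <= d * c -> nm (P d h - h - d *: h') <= d * c ->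
  `|B (P (d + s) f) (Q (P r h)) - B (P s f) (Q (P (d + r) h))|
    <= d * c * (nm f + nm h).
Proof.
move=> ff hh s0 r0 d0 fc hc.
have ge := form_sym (generates_P s0 ff) (generates_P r0 hh).
rewrite !P_semi//.
set a := P s f in ge *; set b := P r h in ge *.
have -> : B (P d a) (Q b) - B a (Q (P d b)) =
    B (P d a - a - d *: P s f') (Q b) - B (Q a) (P d b - b - d *: P r h').
  by rewrite !BBl !BBr BZl BZr -!Q_sym -ge !Q_sym; ring.
rewrite (le_trans (ler_normB _ _))// addrC mulrDr lerD//.
  rewrite (le_trans (cauchy_schwarz_norm _ _))// mulrC ler_pM ?nm_ge0//.
    by rewrite (le_trans (generates_error_P _ _ r0 d0)).
  by rewrite (le_trans (Q_contr _))// P_contr.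
rewrite (le_trans (cauchy_schwarz_norm _ _))// ler_pM ?nm_ge0//.
  by rewrite (le_trans (generates_error_P _ _ s0 d0)).
by rewrite (le_trans (Q_contr _))// P_contr.
Qed.

(** The total [k + m] is preserved at each step, so [m] stays general and the induction hypothesis
    is used at [m.+1]. *)
Lemma form_telescope f f' h h' d c k m : generates f f' -> generates h h' ->
  0 <= d ->
  nm (P d f - f - d *: f') <= d * c -> nm (P d h - h - d *: h') <= d * c ->
  `|B (P (k%:R * d) f) (Q (P (m%:R * d) h)) - B f (Q (P ((k + m)%:R * d) h))|
    <= k%:R * (d * c * (nm f + nm h)).
Proof.
move=> ff hh d0 fc hc; elim: k m => [|k IH] m.
  by rewrite !mul0r P_0 add0n subrr normr0.
have kd0 : 0 <= k%:R * d by rewrite mulr_ge0.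
have md0 : 0 <= m%:R * d by rewrite mulr_ge0.
have := form_step ff hh kd0 md0 d0 fc hc.
have := IH m.+1; rewrite addnS -addSn.
have -> : k.+1%:R * d = d + k%:R * d by rewrite -natr1 mulrDl mul1r addrC.
have -> : m.+1%:R * d = d + m%:R * d by rewrite -natr1 mulrDl mul1r addrC.
have -> : k.+1%:R * (d * c * (nm f + nm h)) =
  k%:R * (d * c * (nm f + nm h)) + d * c * (nm f + nm h).
  by rewrite -natr1 mulrDl mul1r.
move=> h1 h2; rewrite [leRHS]addrC.
by rewrite (le_trans (ler_distD (B (P (k%:R * d) f) (Q (P (d + m%:R * d) h))) _ _))// lerD.
Qed.

Lemma semigroup_form_generates t f f' h h' : 0 <= t ->
  generates f f' -> generates h h' -> B (P t f) (Q h) = B f (Q (P t h)).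
Proof.
rewrite le_eqVlt => /predU1P[<- _ _|t0 ff hh]; first by rewrite !P_0.
apply: (@eq_of_small _ _ (t * (nm f + nm h))) => c /andP[c0 _].
have [r1 r10 h1] := ff _ c0; have [r2 r20 h2] := hh _ c0.
pose r := Num.min r1 r2; have r0 : 0 < r by rewrite /r lt_min r10.
(* More than [t / r] steps, hence [d <= r] and both error bounds hold at [d]. The total error is
   [t * c] times a constant, with [c] arbitrary. *)
pose n := (Num.truncn (t / r)).+1; pose d := t / n%:R.
have d0 : 0 < d by rewrite divr_gt0.
have dr : d <= r.
  have /truncn_itv /andP[_ /ltW] : 0 <= t / r by rewrite divr_ge0// ltW.
  by rewrite -/n ler_pdivrMr// mulrC -ler_pdivrMr.
have nd : n%:R * d = t by rewrite mulrC divfK// pnatr_eq0.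
have dr1 : d <= r1 by rewrite (le_trans dr)// ge_min lexx.
have dr2 : d <= r2 by rewrite (le_trans dr)// ge_min lexx orbT.
have := form_telescope n 0 ff hh (ltW d0) (h1 _ d0 dr1) (h2 _ d0 dr2).
rewrite addn0 mul0r P_0 nd => /le_trans; apply.
have -> : n%:R * (d * c * (nm f + nm h)) = n%:R * d * (c * (nm f + nm h)).
  by ring.
by rewrite nd mulrCA.
Qed.

(** For fixed [t] both sides are continuous in [x] and [y], by contractivity, and the domain is
    dense. *)
Lemma semigroup_form t x y : 0 <= t -> B (P t x) (Q y) = B x (Q (P t y)).
Proof.
move=> t0.
apply: (@eq_of_small _ _ ((nm y + nm (P t x) + 1) + (nm (P t y) + nm x + 1))).
move=> e /andP[e0 e1].
have [u [u' [uu ux]]] := generates_dense x e0.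
have [v [v' [vv vy]]] := generates_dense y e0.
have Pe z w : nm (z - w) <= e -> nm (P t z - P t w) <= e.
  by move=> zw; rewrite -PB// (le_trans (P_contr _ _)).
have h1 := form_close e1 (Pe _ _ ux) vy.
have h2 := form_close e1 ux (Pe _ _ vy).
have -> : B (P t x) (Q y) - B x (Q (P t y)) =
    (B (P t x) (Q y) - B (P t u) (Q v)) - (B x (Q (P t y)) - B u (Q (P t v))).
  by rewrite (semigroup_form_generates t0 uu vv); ring.
by rewrite (le_trans (ler_normB _ _))// mulrDr lerD.
Qed.

End InnerProduct.

(** * The space of classes modulo null functions as a complete inner product space *)

Section Quotient.
Context {d : measure_display} {E : measurableType d} {R : realType}
  (mu : {measure set E -> \bar R}).
Implicit Types f g : E -> R.

Definition L2_pred : {pred E -> R} := fun f => `[< L2 mu f >].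

Lemma L2_zmod_closed : zmod_closed L2_pred.
Proof.
split; first by apply/asboolP; exact: L2_0.
by move=> f g /asboolP Lf /asboolP Lg; apply/asboolP; exact: L2B.
Qed.

HB.instance Definition _ := GRing.isZmodClosed.Build (E -> R) L2_pred L2_zmod_closed.

Record L2fun := MkL2fun { L2val : E -> R ; L2valP : L2val \in L2_pred }.

HB.instance Definition _ := [isSub for L2val].
HB.instance Definition _ := [Choice of L2fun by <:].
HB.instance Definition _ := [SubChoice_isSubZmodule of L2fun by <:].

Definition null : {pred L2fun} := fun f : L2fun => `[< aeq mu (L2val f) (fun=> 0) >].

Lemma null_zmod_closed : zmod_closed null.
Proof.
split; first by apply/asboolP; exact: aeq_refl.
move=> f g /asboolP f0 /asboolP g0; apply/asboolP.
by apply: filterS2 f0 g0 => x /= fx gx; rewrite -[LHS]/(L2val f x - L2val g x) fx gx subrr.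
Qed.

HB.instance Definition _ := GRing.isZmodClosed.Build L2fun null null_zmod_closed.

Definition L2q : Type := Quotient.quot null.
HB.instance Definition _ := GRing.Zmodule.on L2q.

(** Total in [f], with default 0 outside L^2, so that taking classes needs no proof argument. *)
Definition L2fun_of f : L2fun :=
  if pselect (L2 mu f) is left Lf then MkL2fun (asboolT Lf) else 0.

Definition cl f : L2q := \pi_(Quotient.quot null)%qT (L2fun_of f).

Definition rep (x : L2q) : E -> R := L2val (repr x).

Lemma L2_rep x : L2 mu (rep x).
Proof. by apply/asboolP; exact: L2valP. Qed.

Lemma L2val_of f : L2 mu f -> L2val (L2fun_of f) = f.
Proof. by rewrite /L2fun_of; case: pselect. Qed.

Lemma cl_eq f g : L2 mu f -> L2 mu g -> aeq mu f g -> cl f = cl g.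
Proof.
move=> Lf Lg fg; apply/eqP; rewrite /cl -Quotient.idealrBE; apply/asboolP.
apply: filterS fg => x fgx.
by rewrite -[LHS]/(L2val (L2fun_of f) x - L2val (L2fun_of g) x) !L2val_of// fgx subrr.
Qed.

Lemma rep_cl f : L2 mu f -> aeq mu (rep (cl f)) f.
Proof.
move=> Lf; have : (\pi_(Quotient.quot null) (repr (cl f)) ==
    \pi_(Quotient.quot null) (L2fun_of f))%qT by rewrite reprK.
rewrite -Quotient.idealrBE => /asboolP; apply: filterS => x.
rewrite -[X in X = _]/(rep (cl f) x - L2val (L2fun_of f) x) L2val_of//.
by move=> /eqP; rewrite subr_eq0 => /eqP.
Qed.

Lemma clK x : cl (rep x) = x.
Proof.
rewrite /cl -[RHS]reprK; congr (\pi_(Quotient.quot null) _)%qT.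
by apply: val_inj; rewrite /= L2val_of//; exact: L2_rep.
Qed.

Lemma rep_inj x y : aeq mu (rep x) (rep y) -> x = y.
Proof.
move=> xy; rewrite -[x]clK -[y]clK; apply: cl_eq => //; exact: L2_rep.
Qed.

Lemma clD f g : L2 mu f -> L2 mu g -> cl (fun t => f t + g t) = cl f + cl g.
Proof.
move=> Lf Lg; rewrite /cl -[RHS]Quotient.pi_add.
congr (\pi_(Quotient.quot null) _)%qT; apply: val_inj.
rewrite -[RHS]/(L2val (L2fun_of f) + L2val (L2fun_of g)) /= !L2val_of//.
exact: L2D.
Qed.

Lemma repD x y : aeq mu (rep (x + y)) (fun t => rep x t + rep y t).
Proof.
rewrite -{1}[x]clK -{1}[y]clK -clD ?L2_rep//; try exact: L2_rep.
by apply/rep_cl/L2D; exact: L2_rep.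
Qed.

(** The quotient by a subgroup carries only the additive structure; scalars act through a chosen
    representative. *)
Definition scale (a : R) (x : L2q) : L2q := cl (fun t => a * rep x t).

Lemma rep_scale a x : aeq mu (rep (scale a x)) (fun t => a * rep x t).
Proof. by apply/rep_cl/L2Z; exact: L2_rep. Qed.

Lemma L2q_scaleA a b x : scale a (scale b x) = scale (a * b) x.
Proof.
apply: rep_inj; have h1 := rep_scale a (scale b x).
apply: filterS3 h1 (rep_scale b x) (rep_scale (a * b) x) => t -> -> ->.
by rewrite mulrA.
Qed.

Lemma L2q_scale1 : left_id 1 scale.
Proof. by move=> x; apply: rep_inj; apply: filterS (rep_scale 1 x) => t ->; rewrite mul1r. Qed.

Lemma L2q_scaleDr : right_distributive scale +%R.
Proof.
move=> a x y; apply: rep_inj.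
have h1 := rep_scale a (x + y); have h2 := repD (scale a x) (scale a y).
have h3 : aeq mu (rep (scale a (x + y))) (fun t => a * rep x t + a * rep y t).
  by apply: filterS2 h1 (repD x y) => t -> ->; rewrite mulrDr.
have h4 : aeq mu (rep (scale a x + scale a y)) (fun t => a * rep x t + a * rep y t).
  by apply: filterS3 h2 (rep_scale a x) (rep_scale a y) => t -> -> ->.
exact: aeq_trans h3 (aeq_sym h4).
Qed.

Lemma L2q_scaleDl x : {morph scale^~ x : a b / a + b}.
Proof.
move=> a b; apply: rep_inj.
have h1 : aeq mu (rep (scale a x + scale b x)) (fun t => a * rep x t + b * rep x t).
  have h0 := repD (scale a x) (scale b x).
  by apply: filterS3 h0 (rep_scale a x) (rep_scale b x) => t -> -> ->.
apply: filterS2 (rep_scale (a + b) x) h1 => t -> ->.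
by rewrite mulrDl.
Qed.

HB.instance Definition _ := GRing.Zmodule_isLmodule.Build R L2q
  L2q_scaleA L2q_scale1 L2q_scaleDr L2q_scaleDl.

Lemma repZ a x : aeq mu (rep (a *: x)) (fun t => a * rep x t).
Proof. exact: rep_scale. Qed.

Lemma rep_lin a b x y :
  aeq mu (rep (a *: x + b *: y)) (fun t => a * rep x t + b * rep y t).
Proof. by apply: filterS3 (repD (a *: x) (b *: y)) (repZ a x) (repZ b y) => t -> -> ->. Qed.

Lemma cl_lin a b f g : L2 mu f -> L2 mu g ->
  cl (fun t => a * f t + b * g t) = a *: cl f + b *: cl g.
Proof.
move=> Lf Lg; apply: rep_inj; have h1 := rep_cl (L2_lin a b Lf Lg).
have h2 := rep_lin a b (cl f) (cl g).
have h3 := aeq_lin a b (rep_cl Lf) (rep_cl Lg).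
exact: aeq_trans h1 (aeq_sym (aeq_trans h2 h3)).
Qed.

Lemma clB f g : L2 mu f -> L2 mu g -> cl (fun t => f t - g t) = cl f - cl g.
Proof.
move=> Lf Lg; have := cl_lin 1 (-1) Lf Lg; rewrite scale1r scaleN1r => <-.
by congr cl; apply/funext => t; rewrite mul1r mulN1r.
Qed.

Lemma clZ a f : L2 mu f -> cl (fun t => a * f t) = a *: cl f.
Proof.
move=> Lf; have := cl_lin a 0 Lf Lf; rewrite scale0r addr0 => <-.
by congr cl; apply/funext => t; rewrite mul0r addr0.
Qed.

Definition ipq (x y : L2q) : R := ip mu (rep x) (rep y).

Lemma ipq_cl f g : L2 mu f -> L2 mu g -> ipq (cl f) (cl g) = ip mu f g.
Proof.
by move=> Lf Lg; apply: ip_aeq => //; rewrite ?L2_rep//; try exact: L2_rep;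
  exact: rep_cl.
Qed.

Lemma ipqC x y : ipq x y = ipq y x.
Proof. exact: ipC. Qed.

Lemma ipq_lin a b x y z : ipq (a *: x + b *: y) z = a * ipq x z + b * ipq y z.
Proof.
have [Lx Ly Lz] := And3 (L2_rep x) (L2_rep y) (L2_rep z).
rewrite -ip_linl//; apply: ip_aeq => //; try exact: L2_rep.
- exact: L2_lin.
- exact: rep_lin.
- exact: aeq_refl.
Qed.

Lemma ipqDl x y z : ipq (x + y) z = ipq x z + ipq y z.
Proof. by rewrite -[x]scale1r -[y]scale1r ipq_lin !scale1r !mul1r. Qed.

Lemma ipqZl a x z : ipq (a *: x) z = a * ipq x z.
Proof. by rewrite -[a *: x]addr0 -(scale0r 0) ipq_lin mul0r addr0. Qed.

Lemma ipq_ge0 x : 0 <= ipq x x.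
Proof. exact: ip_ge0. Qed.

Lemma nm_cl f : L2 mu f -> nm ipq (cl f) = norm2 mu f.
Proof. by move=> Lf; rewrite /nm ipq_cl. Qed.

Lemma nm_clB f g : L2 mu f -> L2 mu g ->
  nm ipq (cl f - cl g) = norm2 mu (fun t => f t - g t).
Proof. by move=> Lf Lg; rewrite -clB// nm_cl//; exact: L2B. Qed.

Lemma nm_ipqZ a x : 0 < a -> nm ipq (a *: x) = a * nm ipq x.
Proof. by move=> a0; rewrite (nmZ ipqC ipqZl) gtr0_norm. Qed.

Lemma L2q_complete (u : nat -> L2q) :
  (forall e : R, 0 < e -> exists M, forall n, (M <= n)%N ->
     nm ipq (u n - u M) <= e) ->
  exists l, forall e : R, 0 < e -> exists M, forall n, (M <= n)%N ->
     nm ipq (u n - l) <= e.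
Proof.
move=> cu; have Lu n : L2 mu (rep (u n)) by exact: L2_rep.
have [|l Ll ul] := L2_complete Lu.
  move=> e e0; have [M hM] := cu _ (divr_gt0 e0 (ltr0n _ 2)).
  exists M => m n Mm Mn; rewrite -nm_clB// !clK.
  rewrite (le_trans (ler_nm_dist ipqC ipqDl ipqZl ipq_ge0 (u M) _ _))//.
  rewrite [leRHS]splitr; apply: lerD; first exact: hM.
  by rewrite (nmBC ipqC ipqZl); exact: hM.
exists (cl l) => e e0; have [M hM] := ul e e0; exists M => n Mn.
by rewrite -[u n]clK nm_clB// hM.
Qed.

(** [T] acts on a chosen representative; for an [L2_linop] the class of the result is independent of
    the choice. *)
Definition lift (T : (E -> R) -> E -> R) (x : L2q) : L2q := cl (T (rep x)).

Lemma lift_cl T f : L2_linop mu T -> L2 mu f -> lift T (cl f) = cl (T f).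
Proof.
move=> [TL Tae _] Lf; have Lr := L2_rep (cl f); apply: cl_eq; try exact: TL.
by apply: Tae => //; exact: rep_cl.
Qed.

Lemma lift_lin T a x y : L2_linop mu T ->
  lift T (a *: x + y) = a *: lift T x + lift T y.
Proof.
move=> Tlin; have [TL Tae Tl] := Tlin.
rewrite -{1}[x]clK -{1}[y]clK -[cl (rep y)]scale1r -cl_lin; try exact: L2_rep.
rewrite lift_cl//; last by apply: L2_lin; exact: L2_rep.
rewrite -[lift T y]scale1r -cl_lin; try by apply: TL; exact: L2_rep.
apply: cl_eq.
- by apply: TL; apply: L2_lin; exact: L2_rep.
- by apply: L2_lin; apply: TL; exact: L2_rep.
- by apply: Tl; exact: L2_rep.
Qed.

End Quotient.

(** * The Markov semigroup on classes and its generator *)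

Lemma cvg0_at_right {R : realType} (F : R -> R) : (forall t, 0 <= F t) ->
  F t @[t --> 0^'+] --> 0 <->
  (forall e, 0 < e -> exists2 r, 0 < r & forall t, 0 < t -> t <= r -> F t <= e).
Proof.
move=> F0; split => [/cvgrPdist_le Fc e e0|Fe].
  (* Halving turns the open neighbourhood into the closed condition [t <= r]. *)
  have [r /= r0 h] := Fc _ e0; exists (r / 2); first by rewrite divr_gt0.
  move=> t t0 tr; have := h t; rewrite /= !sub0r !normrN (gtr0_norm t0).
  rewrite (ger0_norm (F0 t)); apply => //.
  by rewrite (le_lt_trans tr)// ltr_pdivrMr// ltr_pMr// ltr1n.
apply/cvgrPdist_le => e e0; have [r r0 h] := Fe _ e0.
exists r => //= t; rewrite /= !sub0r !normrN => + t0.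
by rewrite (gtr0_norm t0) (ger0_norm (F0 t)) => /ltW; exact: h.
Qed.

Section Semigroup.
Context {d : measure_display} {E : measurableType d} {R : realType}
  (mu : {measure set E -> \bar R}).
Hypothesis mu_fin : (mu setT < +oo)%E.
Context (P : R -> (E -> R) -> E -> R).
Hypothesis Psg : Markov_semigroup mu P.

Local Notation H := (L2q mu).
Local Notation B := (@ipq _ _ _ mu).
Local Notation Pq := (fun t => lift (mu := mu) (P t)).

Lemma semigroup_linop t : 0 <= t -> L2_linop mu (P t).
Proof. by case: Psg => -[+ _ _ _ _] _; apply. Qed.

Lemma semigroup_L2 t f : 0 <= t -> L2 mu f -> L2 mu (P t f).
Proof. by move=> /semigroup_linop [+ _ _] => /[apply]. Qed.

Lemma lift_semigroup_lin t a (x y : H) : 0 <= t ->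
  Pq t (a *: x + y) = a *: Pq t x + Pq t y.
Proof. by move=> t0; apply: lift_lin; exact: semigroup_linop. Qed.

Lemma lift_semigroup0 (x : H) : Pq 0 x = x.
Proof.
case: Psg => -[_ P0 _ _ _] _; rewrite -[RHS]clK; apply: cl_eq.
- exact/semigroup_L2/L2_rep.
- exact: L2_rep.
- exact/P0/L2_rep.
Qed.

Lemma lift_semigroupD s t (x : H) : 0 <= s -> 0 <= t ->
  Pq (s + t) x = Pq s (Pq t x).
Proof.
move=> s0 t0; case: Psg => -[_ _ PD _ _] _.
have Lx := L2_rep x; have Ltx := semigroup_L2 t0 Lx.
rewrite /= {3}/lift lift_cl//; last exact: semigroup_linop.
apply: cl_eq; last exact: PD.
- by apply: semigroup_L2 => //; exact: addr_ge0.
- exact: semigroup_L2.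
Qed.

Lemma lift_semigroup_contr t (x : H) : 0 <= t -> nm B (Pq t x) <= nm B x.
Proof.
move=> t0; case: Psg => -[Pl _ _ Pp P1] [Pi _].
rewrite /lift nm_cl; last exact/semigroup_L2/L2_rep.
rewrite -[x in leRHS]clK nm_cl; last exact: L2_rep.
by apply: Markov_contraction; rewrite ?L2_rep//;
  [exact: Pl|move=> f Lf; exact: Pp|exact: P1|move=> f Lf; exact: Pi|exact: L2_rep].
Qed.

Lemma lift_semigroup_cont (x : H) (e : R) : 0 < e -> exists2 r : R, 0 < r &
  forall t : R, 0 <= t <= r -> nm B (Pq t x - x) <= e.
Proof.
move=> e0; case: Psg => _ [_ Pc].
have Lx := L2_rep x.
have /cvg0_at_right /(_ _ e0) [t|r r0 h] := Pc _ Lx; first exact: norm2_ge0.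
exists r => // t /andP[]; rewrite le_eqVlt => /predU1P[<- _|t0 tr].
  rewrite lift_semigroup0 subrr -(scale0r 0) nmZ; last 2 first.
  - exact: ipqC.
  - exact: ipqZl.
  by rewrite normr0 mul0r ltW.
rewrite -{2}[x]clK /lift nm_clB//; first exact: h.
by apply: semigroup_L2 => //; exact: ltW.
Qed.

(** The error of the multiplied-out quotient is [t] times the norm of the difference quotient minus
    [g]. *)
Lemma generates_gen_at f g : L2 mu f -> L2 mu g ->
  generates B Pq (cl mu f) (cl mu g) <-> gen_at mu P f g.
Proof.
move=> Lf Lg.
have E1 t : 0 < t -> nm B (Pq t (cl mu f) - cl mu f - t *: cl mu g) =
    t * norm2 mu (fun x => t^-1 * (P t f x - f x) - g x).
  move=> t0; have LP := semigroup_L2 (ltW t0) Lf.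
  have LB := L2B LP Lf.
  rewrite lift_cl//; last exact/semigroup_linop/ltW.
  rewrite -nm_cl; last by apply: L2B => //; exact: L2Z.
  rewrite -nm_ipqZ// clB//; last exact: L2Z.
  by rewrite clZ// clB// scalerBr scalerA divff ?gt_eqF// scale1r.
split => [fg|[_ [_ /cvg0_at_right fg]]].
  split => //; split => //; apply/cvg0_at_right => [t|e e0].
    exact: norm2_ge0.
  have [r r0 h] := fg _ e0; exists r => // t t0 tr.
  by have := h t t0 tr; rewrite E1// ler_pM2l.
move=> e e0; have [t|r r0 h] := fg _ e e0; first exact: norm2_ge0.
exists r => // t t0 tr.
by rewrite E1// ler_pM2l// h.
Qed.

(** At a common small [t] the two errors give [t * nm B (y - y') <= t * e]. This shows that [L]
    agrees, up to null sets, on functions equal almost everywhere. *)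
Lemma generates_unique (x y y' : H) :
  generates B Pq x y -> generates B Pq x y' -> y = y'.
Proof.
move=> xy xy'.
have BD := @ipqDl _ _ _ mu; have BZ := @ipqZl _ _ _ mu.
have BC := @ipqC _ _ _ mu; have B0 := @ipq_ge0 _ _ _ mu.
suff yy : nm B (y - y') = 0.
  apply: rep_inj; move: yy; rewrite -{1}[y]clK -{1}[y']clK nm_clB; try exact: L2_rep.
  move=> /(norm2_eq0 (L2B (L2_rep _) (L2_rep _))).
  by apply: filterS => t /eqP; rewrite subr_eq0 => /eqP.
apply/eqP; rewrite eq_le nm_ge0 andbT; apply/ler_addgt0Pr => e e0; rewrite add0r.
have e20 : 0 < e / 2 by rewrite divr_gt0.
have [r r0 h] := xy _ e20; have [r' r'0 h'] := xy' _ e20.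
pose t := Num.min r r'; have t0 : 0 < t by rewrite lt_min r0.
have h1 : nm B (Pq t x - x - t *: y) <= t * (e / 2) by apply: h; rewrite ?ge_min ?lexx.
have h2 : nm B (Pq t x - x - t *: y') <= t * (e / 2).
  by apply: h'; rewrite ?ge_min ?lexx ?orbT.
rewrite -(ler_pM2l t0) -nm_ipqZ//.
have -> : t *: (y - y') = (Pq t x - x - t *: y') - (Pq t x - x - t *: y).
  by rewrite opprB [RHS]addrC addrA subrK scalerBr.
rewrite (le_trans (ler_nmD BC BD BZ B0 _ _))// (nmN BC BZ).
by rewrite [e in leRHS]splitr mulrDr lerD.
Qed.

End Semigroup.

(** * Transfer from functions to classes and back *)

Theorem theorem4p4 (d : measure_display) (E : measurableType d) (R : realType)
  (mu : probability E R) (P : R -> (E -> R) -> (E -> R))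
  (L : (E -> R) -> (E -> R)) (Q : (E -> R) -> (E -> R)) (A : set (E -> R)) :
  Markov_semigroup mu P ->
  is_generator mu P L ->
  isometric_involution mu Q ->
  is_core mu P L A ->
  (forall f, A f -> A (Q f)) ->
  (forall f g, A f -> A g -> ip mu (L f) g = ip mu f (Q (L (Q g)))) ->
  forall t, 0 <= t -> forall f g, L2 mu f -> L2 mu g ->
    ip mu (P t f) g = ip mu f (Q (P t (Q g))).
Proof.
move=> Psg Lgen [Qlin Qiso Qinv] [AD _ _ Acore] AQ Lsym.
set m : {measure set E -> \bar R} := mu in Psg Lgen Qlin Qiso Qinv AD Acore Lsym *.
have mfin : (m setT < +oo)%E by rewrite /m/= probability_setT ltry.
pose B := @ipq _ _ _ m; pose Pq t := lift (mu := m) (P t).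
pose Qq := lift (mu := m) Q.
have [QL Qae _] := Qlin.
have AL2 f : A f -> L2 m f by move=> /AD [g []].
have ALL2 f : A f -> L2 m (L f) by move=> /AD/Lgen [_ []].
have Agen f : A f -> generates B Pq (cl m f) (cl m (L f)).
  move=> Af; apply/generates_gen_at => //; [exact: AL2|exact: ALL2|].
  exact/Lgen/AD.
have Q_cl f : L2 m f -> Qq (cl m f) = cl m (Q f) by move=> Lf; exact: lift_cl.
have Q_invol x : Qq (Qq x) = x.
  rewrite -[x]clK; have Lx := L2_rep x.
  by rewrite !Q_cl//; [apply: cl_eq => //; [exact/QL/QL|exact: Qinv]|exact: QL].
have Q_iso x y : B (Qq x) (Qq y) = B x y.
  rewrite -[x]clK -[y]clK !Q_cl; try exact: L2_rep.
  rewrite /B !ipq_cl; try exact: L2_rep; try exact/QL/L2_rep.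
  by apply: Qiso; exact: L2_rep.
have Q_sym x y : B (Qq x) y = B x (Qq y) by rewrite -Q_iso Q_invol.
have Q_contr x : nm B (Qq x) <= nm B x by rewrite /nm Q_iso.
(* The graph of [L] restricted to [A], read on classes. *)
pose C x y := exists f, [/\ A f, x = cl m f & y = cl m (L f)].
have Ccore x y : generates B Pq x y -> forall e, 0 < e ->
    exists u v, [/\ C u v, nm B (u - x) <= e & nm B (v - y) <= e].
  move=> xy e e0; have Lx := L2_rep x; have Ly := L2_rep y.
  have xyD : gen_at m P (rep x) (rep y) by apply/generates_gen_at; rewrite ?clK.
  have xD : D2 m P (rep x) by exists (rep y).
  have [_ [LLx _]] := Lgen _ xD.
  have yL : aeq m (rep y) (L (rep x)).
    have : y = cl m (L (rep x)).
      apply: (generates_unique xy).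
      by rewrite -{1}[x]clK; apply/generates_gen_at => //; exact: Lgen.
    by move=> ->; exact: rep_cl.
  have [u [Au [ux uy]]] := (Acore _ _ Lx Ly).2 (conj xD yL).
  move/cvgrPdist_le : ux => /(_ e e0) [N1 _ h1].
  move/cvgrPdist_le : uy => /(_ e e0) [N2 _ h2].
  pose n := maxn N1 N2; exists (cl m (u n)), (cl m (L (u n))); split.
  - by exists (u n).
  - have := h1 n (leq_maxl _ _); rewrite /= sub0r normrN ger0_norm ?norm2_ge0//.
    by rewrite -[x in _ - x]clK nm_clB//; exact: AL2.
  - have := h2 n (leq_maxr _ _); rewrite /= sub0r normrN ger0_norm ?norm2_ge0//.
    by rewrite -[y in _ - y]clK nm_clB//; exact: ALL2.
have Csym u v w z : C u v -> C w z -> B v (Qq w) = B (Qq u) z.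
  move=> [f [Af -> ->]] [h [Ah -> ->]].
  have [Lf Lh] := (AL2 _ Af, AL2 _ Ah).
  (* The symmetry hypothesis at [f] and [Q h] produces [L (Q (Q h))]. As [Q (Q h)] is [h] only
     almost everywhere, uniqueness of the generator's value identifies this with [L h] on
     classes. *)
  have AQQ : A (Q (Q h)) by exact/AQ/AQ.
  have QQh : cl m (L (Q (Q h))) = cl m (L h).
    apply: generates_unique (Agen _ AQQ) _.
    by rewrite -!Q_cl// ?Q_invol; [exact: Agen|exact: QL].
  rewrite Q_cl// /B ipq_cl; [|exact: ALL2|exact: QL].
  rewrite Lsym//; last exact: AQ.
  rewrite -ipq_cl//; last exact/QL/ALL2.
  rewrite -Q_cl; last exact: ALL2.
  by rewrite QQh; exact/esym/Q_sym.
have form_sym x y x' y' : generates B Pq x y -> generates B Pq x' y' ->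
    B y (Qq x') = B (Qq x) y'.
  exact: (form_symmetric_closure (@ipqC _ _ _ m) (@ipqDl _ _ _ m)
    (@ipqZl _ _ _ m) (@ipq_ge0 _ _ _ m) Q_sym Q_contr Ccore Csym).
have sym t (x y : L2q m) : 0 <= t -> B (Pq t x) (Qq y) = B x (Qq (Pq t y)).
  exact: (semigroup_form (@ipqC _ _ _ m) (@ipqDl _ _ _ m) (@ipqZl _ _ _ m)
    (@ipq_ge0 _ _ _ m) (@L2q_complete _ _ _ m) (lift_semigroup_lin Psg)
    (lift_semigroup0 Psg) (lift_semigroupD Psg) (lift_semigroup_contr mfin Psg)
    (lift_semigroup_cont Psg) Q_sym Q_contr form_sym).
move=> t t0 f g Lf Lg.
have LP h : L2 m h -> L2 m (P t h) by exact: semigroup_L2.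
have P_cl h : L2 m h -> Pq t (cl m h) = cl m (P t h).
  by move=> Lh; apply: lift_cl => //; exact: (semigroup_linop Psg t0).
rewrite -ipq_cl//; last exact: LP.
(* Writing the class of [g] as [Qq] applied twice to it puts the left side in the form required by
   [sym], with second argument the class of [Q g]. *)
rewrite -P_cl// -(Q_invol (cl m g)) [LHS]sym// Q_cl// P_cl; last exact: QL.
rewrite Q_cl; last exact/LP/QL.
by rewrite /B ipq_cl//; exact/QL/LP/QL.
Qed.
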